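(* Let $\{S(t): t\ge 0\}$ be a semigroup on a nonempty subset $V$ of a Hilbert space $(X,\|\cdot\|_X)$ over $\mathbb{K}\in\{\mathbb{R},\mathbb{C}\}$, $T>0$ and let $B$ be a bounded subset of $V$ such that $S(T)B\subseteq B$. If the semigroup is of Ladyzhenskaya type on $B$ at time $T$ with parameters $(n,\eta,\kappa)$ with an orthogonal projection $P:X\to X_n$ onto an $n$-dimensional subspace $X_n$ of $X$, then for any $\sigma\in(0,\sqrt{1-\eta^2})$ there exist $k_0\in\mathbb{N}$ and $a,b>0$ such that the covering condition $$N^{V}(S(kT)B,aq^{k})\le b h^{k},\quad k\in\mathbb{N},\ k\ge k_0,$$ holds with $q=\sqrt{\sigma^2+\eta^2}$ and $$h=\left(1+\tfrac{2\kappa}{\sigma}\right)^{\mathbf{n}},$$ where $\mathbf{n}=n$ if $\mathbb{K}=\mathbb{R}$ and $\mathbf{n}=2n$ if $\mathbb{K}=\mathbb{C}$.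
   Context: $\mathbb{N}=\{1,2,\dots\}$. $V$ carries the metric $d(x,y)=\|x-y\|_X$. A semigroup $\{S(t):t\ge0\}$ on $V$ is a family of (not necessarily linear) maps $S(t):V\to V$ with $S(t)S(s)=S(t+s)$ for $t,s\ge 0$ and $S(0)=I$; ''$t\ge 0$'' means throughout either $t\in[0,\infty)$ or $t\in\mathbb{N}\cup\{0\}$ (and $T$ belongs to the time set). Ladyzhenskaya type on $B\subseteq V$ at time $T>0$ with parameters $(n,\eta,\kappa)$ with the map $P$ into the $n$-dimensional subspace $X_n$ ($n\in\mathbb{N}$): $\eta\in[0,1)$, $\kappa>0$ and for all $x,y\in B$ $$\|(I-P)S(T)x-(I-P)S(T)y\|_X\le\eta\|x-y\|_X,\qquad\|PS(T)x-PS(T)y\|_X\le\kappa\|x-y\|_X.$$ $N^V(G,\varepsilon)$ is the minimal number of open $\varepsilon$-balls in $V$ centered at points of $G$ needed to cover $G$. *)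

(* Defs.v *)
From HB Require Import structures.
From mathcomp Require Import all_boot all_order all_algebra.
From mathcomp Require Import sesquilinear complex.
From mathcomp Require Import boolp classical_sets reals ereal topology normedtype.

Set Implicit Arguments.
Unset Strict Implicit.
Unset Printing Implicit Defensive.

Import Order.TTheory GRing.Theory Num.Theory.
Import numFieldNormedType.Exports.

Local Open Scope classical_set_scope.
Local Open Scope ring_scope.
Local Open Scope complex_scope.

Inductive scalar_kind := RealScalars | ComplexScalars.

Definition scalars (R : realType) (c : scalar_kind) : numFieldType :=
  match c with
  | RealScalars => R
  | ComplexScalars => R[i]
  end.

Definition of_real (R : realType) (c : scalar_kind) : R -> scalars R c :=
  match c with
  | RealScalars => fun x => x
  | ComplexScalars => fun x => x%:C
  end.

Definition scalar_conj (R : realType) (c : scalar_kind) :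
    involutive_rmorphism (scalars R c) :=
  match c with
  | RealScalars => (@idfun R : involutive_rmorphism R)
  | ComplexScalars => (@Num.conj R[i] : involutive_rmorphism R[i])
  end.

Definition real_dim (c : scalar_kind) (n : nat) : nat :=
  match c with
  | RealScalars => n
  | ComplexScalars => (2 * n)%N
  end.

(* Hilbert space: complete normed space whose norm comes from [dot]; [dot] is
   linear in its first and conjugate-linear in its second argument. *)
Definition hilbert_norm (R : realType) (c : scalar_kind)
    (X : completeNormedModType (scalars R c)) (dot : {dot X for @scalar_conj R c}) :=
  forall x : X, `|x| ^+ 2 = dot x x.

Definition subspace_of_dim (K : fieldType) (X : lmodType K) (n : nat)
    (W : set X) :=
  exists e : 'I_n -> X,
    (forall u : 'I_n -> K, \sum_(i < n) u i *: e i = 0 -> forall i, u i = 0) /\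
    W = [set \sum_(i < n) u i *: e i | u in [set: 'I_n -> K]].

Definition orthogonal_projection (R : realType) (c : scalar_kind)
    (X : completeNormedModType (scalars R c)) (dot : {dot X for @scalar_conj R c})
    (P : X -> X) (W : set X) :=
  [/\ linear P, forall x, P (P x) = P x, range P = W &
      forall x y, P y = 0 -> dot (P x) y = 0].

Inductive time_kind := ContinuousTime | DiscreteTime.

Definition time_set (R : realType) (tk : time_kind) : set R :=
  match tk with
  | ContinuousTime => [set t | 0 <= t]
  | DiscreteTime => [set k%:R | k in [set: nat]]
  end.

(* Self-maps of V are total maps of X preserving V; their values off V, and off
   the time set, are irrelevant. *)
Definition semigroup_on (R : realType) (X : Type) (tk : time_kind) (V : set X)
    (S : R -> X -> X) :=
  [/\ forall t, time_set tk t -> forall x, V x -> V (S t x),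
      forall t s, time_set tk t -> time_set tk s ->
        forall x, V x -> S t (S s x) = S (t + s) x
    & forall x, V x -> S 0 x = x].

Definition ladyzhenskaya_type (R : realType) (c : scalar_kind)
    (X : completeNormedModType (scalars R c)) (S : R -> X -> X) (B : set X)
    (T : R) (n : nat) (eta kappa : R) (W : set X) (P : X -> X) :=
  [/\ (0 < n)%N /\ subspace_of_dim n W, forall x, W (P x),
      0 <= eta < 1, 0 < kappa &
      forall x y, B x -> B y ->
        `|(S T x - P (S T x)) - (S T y - P (S T y))|
          <= of_real c eta * `|x - y| /\
        `|P (S T x) - P (S T y)| <= of_real c kappa * `|x - y|].

(* Minimal number of open eps-balls of V centred in G covering G, in \bar R;
   it is +oo when there is no finite cover. *)
Definition covering_number (R : realType) (c : scalar_kind)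
    (X : completeNormedModType (scalars R c)) (V G : set X) (eps : R) : \bar R :=
  ereal_inf [set ((size s)%:R)%:E | s in
    [set s : seq X | (forall x, x \in s -> G x) /\
       forall y, G y ->
         exists2 x, x \in s & (V `&` ball x (of_real c eps)) y]].

(* Main.v *)
Require Import Defs.
From HB Require Import structures.
From mathcomp Require Import all_boot all_order all_algebra.
From mathcomp Require Import sesquilinear complex.
From mathcomp Require Import finmap zify ring lra.
From mathcomp Require Import boolp classical_sets reals ereal topology normedtype.

(* One covers [S (k T) B] by at most [h ^ k] sets of diameter at most [d q ^ k],
   rather than by balls: tracking diameters is what makes [q] come out as
   [sqrt (sigma ^ 2 + eta ^ 2)], since the centre of a covering ball of the
   projected image need not come from a point of [B].  If [A] has diameter [d],
   then [P (S T A)] has diameter at most [kappa d]; the balls of radius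
   [sigma d / 2] around a maximal [sigma d / 2]-separated subset of it split
   [S T A] into pieces whose diameter is at most [q d], by Pythagoras.

   The number of pieces is at most [h] because a [delta]-separated set of
   diameter [D] in real dimension [N] has at most [(1 + D / delta) ^ N] points.
   With the balls of radius [delta / 2] around the points, this is the
   isodiametric inequality, i.e. the case [|A - A| >= 2 ^ N |A|] of
   Brunn-Minkowski.  It is obtained here from its discrete form
   [|A - A + {0,1} ^ N| >= 2 ^ N |A|] for finite [A] in [Z ^ N]. *)

Set Implicit Arguments.
Unset Strict Implicit.
Unset Printing Implicit Defensive.

Import Order.TTheory GRing.Theory Num.Theory.
Import numFieldNormedType.Exports.

Local Open Scope classical_set_scope.
Local Open Scope ring_scope.

(** * Discrete Brunn-Minkowski *)

Section DiscreteBrunnMinkowski.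
Local Open Scope fset_scope.
Local Open Scope ring_scope.

Lemma fset_int_max (A : {fset int}) :
  A != fset0 -> exists2 a, a \in A & forall x, x \in A -> x <= a.
Proof.
case/fset0Pn => a0 a0A; pose M := (\max_(a : A) `|(val a - a0)%R|)%N.
have AM x : x \in A -> x <= a0 + M%:Z.
  move=> xA; have : (`|(x - a0)%R| <= M)%N; last by lia.
  exact: (leq_bigmax (FSetSub xA)).
(* The maximum is the element closest to the upper bound [a0 + M]. *)
pose a := [arg min_(b < FSetSub a0A : A) `|(a0 + M%:Z - val b)%R|%N].
exists (val a) => [|x xA]; first exact: valP.
rewrite /a; case: arg_minnP => // b _ /(_ (FSetSub xA) isT) /=.
have := AM _ xA; have := AM _ (valP b); lia.
Qed.

(** With [a] and [b] the maxima of [F] and [G], the translate [F - b] lies at or below [a - b] and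
    the reflection [a - G + 1] strictly above it, so [C] contains both disjointly. *)
Lemma card_fset_int_sub (F G C : {fset int}) : F != fset0 -> G != fset0 ->
    (forall x y, x \in F -> y \in G -> x - y \in C /\ x - y + 1 \in C) ->
  (#|` F| + #|` G| <= #|` C|)%N.
Proof.
move=> /fset_int_max[a aF amax] /fset_int_max[b bG bmax] FGC.
pose U := [fset x - b | x in F]; pose V := [fset a - y + 1 | y in G].
have <- : #|` U| = #|` F| by rewrite card_imfset // => x y /addIr.
have <- : #|` V| = #|` G| by rewrite card_imfset // => x y /addIr /addrI /oppr_inj.
have UV0 : U `&` V = fset0.
  apply/fsetP => z; rewrite inE in_fset0; apply/negbTE/negP => /andP[].
  case/imfsetP => x /= /amax xa -> /imfsetP[y /= /bmax yb]; lia.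
rewrite -cardfsUI UV0 cardfs0 addn0; apply/fsubset_leq_card/fsubsetP => z.
rewrite inE => /orP[] /imfsetP[x /= xA ->].
- by have [] := FGC _ _ xA bG.
- by have [] := FGC _ _ aF xA.
Qed.

Section Fibres.
Variable G : choiceType.
Implicit Types (A C : {fset (G * int)%type}).

Definition fibre A (x : G) : {fset int} := [fset p.2 | p in A & p.1 == x].

Definition base A : {fset G} := [fset p.1 | p in A].

Lemma in_fibre A x t : (t \in fibre A x) = ((x, t) \in A).
Proof.
apply/imfsetP/idP => [[[y u] /=]|xtA]; last by exists (x, t); rewrite ?inE ?xtA /=.
by rewrite !inE /= => /andP[yuA /eqP <-] ->.
Qed.

Lemma card_fibres A : #|` A| = (\sum_(x <- base A) #|` fibre A x|)%N.
Proof.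
rewrite card_fset_sum1 (partition_big_imfset _ (fun p : G * int => p.1)) /=.
apply: eq_bigr => x _; rewrite card_fset_sum1.
rewrite big_imfset /= => [|[y t] [z u]]; last first.
  by move=> /andP[_ /eqP /= ->] /andP[_ /eqP /= ->] /= ->.
by rewrite big_filter.
Qed.

End Fibres.

(** The discrete Brunn-Minkowski property, with [Q] in the role of the discrete unit cube; letting
    [C] be any finite superset of [A - A + Q] avoids forming the sumset. *)
Definition doubling (G : zmodType) (Q : pred G) (N : nat) :=
  forall A C : {fset G},
    (forall x y e, x \in A -> y \in A -> Q e -> x - y + e \in C) ->
  (2 ^ N * #|` A| <= #|` C|)%N.

(** Layer-cake identity: summing over the thresholds [j] recovers the size of a fibre. *)
Lemma sum_ltn m M : (\sum_(0 <= j < M) (j < m) = minn m M)%N.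
Proof.
elim: M => [|M IH]; first by rewrite big_geq ?minn0.
by rewrite big_nat_recr //= IH; lia.
Qed.

Lemma card_fset_sum (T : choiceType) (B : {fset T}) (P : pred T) :
  #|` [fset x in B | P x]| = (\sum_(x <- B) P x)%N.
Proof.
by rewrite card_fset_sum1 big_fset /= big_mkcond; apply: eq_bigr => x _; case: (P x).
Qed.

(* Slice by fibre size: if [L j] is the set of base points whose fibre in [A] has
   more than [j] elements, then over [L j - L j + Q] the fibres of [C] have at
   least [2 (j + 1)] elements, so summing over [j] reduces to the base. *)
Lemma doubling_prod (G : zmodType) (Q : pred G) (N : nat) :
  doubling Q N ->
  doubling (fun p : (G * int)%type => Q p.1 && ((p.2 == 0) || (p.2 == 1))) N.+1.
Proof.
move=> GQ A C AC.
pose f x := #|` fibre A x|; pose g w := #|` fibre C w|.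
have fA x : (f x <= #|` A|)%N.
  apply: leq_trans (leq_imfset_card _ _ _) _ => /=.
  by rewrite size_filter count_size.
set M := #|` A| in fA.
pose L j := [fset x in base A | (j < f x)%N].
pose D j := [fset w in base C | (j.+1.*2 <= g w)%N].
have LD j : (2 ^ N * #|` L j| <= #|` D j|)%N.
  apply: GQ => x y e; rewrite !inE /= => /andP[_ xj] /andP[_ yj] Qe.
  have fx0 : fibre A x != fset0 by rewrite -cardfs_gt0; apply: leq_trans xj.
  have fy0 : fibre A y != fset0 by rewrite -cardfs_gt0; apply: leq_trans yj.
  have fC t u : t \in fibre A x -> u \in fibre A y ->
      t - u \in fibre C (x - y + e) /\ t - u + 1 \in fibre C (x - y + e).
    rewrite !in_fibre => xt yu; split.
    - by rewrite -[t - u]addr0; apply: (AC _ _ (e, 0) xt yu); rewrite /= Qe.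
    - by apply: (AC _ _ (e, 1) xt yu); rewrite /= Qe.
  have jg : (j.+1.*2 <= g (x - y + e)%R)%N.
    rewrite -addnn; apply: leq_trans (card_fset_int_sub fx0 fy0 fC).
    exact: leq_add.
  rewrite jg andbT.
  have /fset0Pn[t] : fibre C (x - y + e) != fset0.
    by rewrite -cardfs_gt0; apply: leq_trans jg.
  by rewrite in_fibre => xtC; apply/imfsetP; exists (x - y + e, t).
have AE : #|` A| = (\sum_(0 <= j < M) #|` L j|)%N.
  rewrite card_fibres; under [RHS]eq_bigr do rewrite card_fset_sum.
  rewrite exchange_big /=; apply: eq_bigr => x _; rewrite sum_ltn.
  by apply/esym/minn_idPl.
have CE : (\sum_(0 <= j < M) (#|` D j|).*2 <= #|` C|)%N.
  rewrite card_fibres; under eq_bigr do rewrite card_fset_sum -mul2n big_distrr /=.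
  rewrite exchange_big /=; apply: leq_sum => w _; rewrite -/(g w).
  rewrite -big_distrr /= mul2n.
  (* Only the [(g w)./2] smallest thresholds are met, so counting each of them twice stays within
     [g w]. *)
  have gE j : (j.+1.*2 <= g w)%N = (j < (g w)./2)%N by lia.
  under eq_bigr do rewrite gE.
  by rewrite sum_ltn; lia.
rewrite AE big_distrr /=; apply: leq_trans CE; apply: leq_sum => j _.
by rewrite expnS -mulnA -mul2n leq_mul2l LD.
Qed.

End DiscreteBrunnMinkowski.

(** * Packing by lattice point counting *)

(** [Z ^ n] as an iterated product, so that [doubling_prod] adds one coordinate at a time; the
    trivial group ['I_1] stands for [Z ^ 0]. *)
Fixpoint lattice (n : nat) : zmodType :=
  if n is n'.+1 then (lattice n' * int)%type : zmodType else 'I_1 : zmodType.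

Fixpoint zcoord (n : nat) : lattice n -> nat -> int :=
  if n is n'.+1 then
    fun (k : (lattice n' * int)%type) i => if i == n' then k.2 else zcoord k.1 i
  else fun _ _ => 0.

Fixpoint cube (n : nat) : pred (lattice n) :=
  if n is n'.+1 then
    fun k : (lattice n' * int)%type => cube k.1 && ((k.2 == 0) || (k.2 == 1))
  else predT.

Fixpoint lattice_of (g : nat -> int) (n : nat) : lattice n :=
  if n is n'.+1 then (lattice_of g n', g n') else 0.

Fixpoint lattice_box (M n : nat) : seq (lattice n) :=
  if n is n'.+1 then
    [seq (k, i%:Z - M%:Z) | k <- lattice_box M n', i <- iota 0 M.*2.+1]
  else [:: 0].

Lemma zcoordD n (k l : lattice n) i : zcoord (k + l) i = zcoord k i + zcoord l i.
Proof.
elim: n k l => [|n IH] k l /=; first by rewrite addr0.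
by case: (i == n) => //; apply: IH.
Qed.

Lemma zcoordN n (k : lattice n) i : zcoord (- k) i = - zcoord k i.
Proof.
elim: n k => [|n IH] k /=; first by rewrite oppr0.
by case: (i == n) => //; apply: IH.
Qed.

Lemma zcoord_cube n (k : lattice n) i : cube k -> (zcoord k i == 0) || (zcoord k i == 1).
Proof.
elim: n k => [|n IH] k //= /andP[k1 k2].
by case: (i == n) => //; apply: IH.
Qed.

Lemma zcoord_lattice_of g n i : (i < n)%N -> zcoord (lattice_of g n) i = g i.
Proof.
by elim: n => [|n IH] //=; rewrite ltnS leq_eqVlt; case: eqP => [->|].
Qed.

Lemma mem_lattice_box M n (k : lattice n) :
  (forall i, (i < n)%N -> (`|zcoord k i| <= M)%N) -> k \in lattice_box M n.
Proof.
elim: n k => [|n IH] k kM /=; first by rewrite [k]ord1 inE.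
case: k kM => k t kM.
have /= := kM n (leqnn _); rewrite eqxx => tM.
have -> : t = `|(t + M%:Z)%R|%N%:Z - M%:Z by lia.
have kin : k \in lattice_box M n.
  apply: IH => i lin; have := kM i (ltnW lin); rewrite /= ifN //.
  by rewrite neq_ltn lin.
have tin : `|(t + M%:Z)%R|%N \in iota 0 M.*2.+1 by rewrite mem_iota; lia.
exact: (@allpairs_f _ _ (lattice n.+1) (fun (k : lattice n) (i : nat) =>
  (k, i%:Z - M%:Z)) _ _ _ _ kin tin).
Qed.

Lemma size_lattice_box M n : size (lattice_box M n) = (M.*2.+1 ^ n)%N.
Proof.
elim: n => [|n IH] //; apply: etrans (size_allpairs _ _ _) _.
by rewrite IH size_iota expnSr.
Qed.

Lemma doubling_lattice n : doubling (@cube n) n.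
Proof.
elim: n => [|n IH]; last exact: doubling_prod.
move=> A C AC; rewrite mul1n; have [->|/fset0Pn[a aA]] := eqVneq A fset0%fset.
  by rewrite cardfs0.
apply/fsubset_leq_card/fsubsetP => x xA.
by rewrite -[x](_ : x - x + 0 = _) ?AC //; apply/val_inj; rewrite !ord1.
Qed.

(** If [a > b], Bernoulli's inequality makes [(a / b) ^ j] grow at least linearly and overtake [C].
    This removes constant factors from the packing estimate. *)
Lemma ler_of_exprn_bound (R : archiRealFieldType) (a b C : R) :
  0 < b -> 0 <= C -> (forall j, a ^+ j <= C * b ^+ j) -> a <= b.
Proof.
move=> b0 C0 ab; rewrite leNgt; apply/negP => ba.
have t0 : 0 < a / b - 1 by rewrite subr_gt0 ltr_pdivlMr ?mul1r.
have bern j : 1 + j%:R * (a / b - 1) <= (a / b) ^+ j.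
  elim: j => [|j IH]; first by rewrite mul0r addr0.
  rewrite exprSr; set t := a / b in IH t0 *.
  have : (1 + j%:R * (t - 1)) * t <= t ^+ j * t by apply: ler_wpM2r => //; lra.
  apply: le_trans; rewrite -natr1.
  have : 0 <= j%:R * (t - 1) ^+ 2 by rewrite mulr_ge0 ?sqr_ge0.
  by lra.
pose j := (Num.truncn (C / (a / b - 1))).+1.
have : C < j%:R * (a / b - 1).
  by rewrite -ltr_pdivrMr // truncnS_gt.
apply/negP; rewrite -leNgt.
have : (a / b) ^+ j <= C by rewrite expr_div_n ler_pdivrMr ?exprn_gt0.
by have := bern j; lra.
Qed.

Section Packing.
Local Open Scope fset_scope.
Local Open Scope ring_scope.
Variables (R : archiRealFieldType) (X : zmodType) (nrm : X -> R).
Hypothesis nrmD : forall x y, nrm (x + y) <= nrm x + nrm y.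
Hypothesis nrmN : forall x, nrm (- x) = nrm x.
Hypothesis nrmMn : forall x m, nrm (x *+ m) = m%:R * nrm x.

Variables (N : nat) (e : nat -> X).

Definition lattice_vec (k : lattice N) : X := \sum_(i < N) e i *~ zcoord k i.

(** [W] models a real subspace, [c0] the covering radius of the lattice in it, and [K] the control
    of integer coordinates by the norm. *)
Variables (W : X -> Prop) (c0 K : R).
Hypothesis W_MulrMn : forall x m, W x -> W (x *+ m).
Hypothesis W_round : forall x, W x -> exists k, nrm (x - lattice_vec k) <= c0.
Hypothesis K_ge0 : 0 <= K.
Hypothesis lattice_coord : forall (k : lattice N) i, (i < N)%N ->
  `|zcoord k i|%:~R <= K * nrm (lattice_vec k).

Let nrm0 : nrm 0 = 0. Proof. by rewrite -(mulr0n 0) nrmMn mul0r. Qed.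

Let nrm_ge0 x : 0 <= nrm x.
Proof. by have := nrmD x (- x); rewrite subrr nrm0 nrmN; lra. Qed.

Let distC x y : nrm (x - y) = nrm (y - x).
Proof. by rewrite -nrmN opprB. Qed.

Let dist x y z t : nrm (x - t) <= nrm (x - y) + nrm (y - z) + nrm (z - t).
Proof.
rewrite -[x - t](subrKA z) -[x - z](subrKA y).
by apply: le_trans (nrmD _ _) _; rewrite lerD2r.
Qed.

Lemma lattice_vecD k l : lattice_vec (k + l) = lattice_vec k + lattice_vec l.
Proof.
by rewrite -big_split; apply: eq_bigr => i _; rewrite zcoordD mulrzDr.
Qed.

Lemma lattice_vecN k : lattice_vec (- k) = - lattice_vec k.
Proof. by rewrite -sumrN; apply: eq_bigr => i _; rewrite zcoordN mulrNz. Qed.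

Lemma lattice_vec_cube k : cube k -> nrm (lattice_vec k) <= \sum_(i < N) nrm (e i).
Proof.
move=> kQ; rewrite /lattice_vec.
elim/big_ind2: _ => [|x a y b xa yb|i _]; first by rewrite nrm0.
  by apply: le_trans (nrmD _ _) _; apply: lerD.
by have /orP[/eqP->|/eqP->] := zcoord_cube i kQ; rewrite ?mulr0z ?nrm0.
Qed.

(** Filtering a box makes the ball a finite set; by [lattice_coord] the box misses no lattice vector
    of norm at most [r]. *)
Definition lattice_ball (r : R) : {fset lattice N} :=
  [fset k in lattice_box (Num.truncn (K * r)) N | nrm (lattice_vec k) <= r].

Lemma in_lattice_ball r k : (k \in lattice_ball r) = (nrm (lattice_vec k) <= r).
Proof.
rewrite !inE /=; case: (leP (nrm _)) => kr; rewrite ?andbF // andbT.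
apply: mem_lattice_box => i /(lattice_coord k) h.
have Kr : `|zcoord k i|%:~R <= K * r :> R by apply: le_trans h _; apply: ler_wpM2l.
rewrite -ltnS -(ltr_nat R); apply: le_lt_trans (truncnS_gt _).
by apply: le_trans Kr; rewrite -abszE.
Qed.

Lemma card_lattice_ball r : 0 <= r -> #|` lattice_ball r|%:R <= (2 * K * r + 1) ^+ N.
Proof.
move=> r0; set M := Num.truncn (K * r).
have : (#|` lattice_ball r| <= M.*2.+1 ^ N)%N.
  rewrite -(size_lattice_box M N); apply: leq_trans (leq_imfset_card _ _ _) _ => /=.
  by rewrite size_filter (leq_trans (count_size _ _)) // size_undup.
rewrite -(ler_nat R) natrX => /le_trans; apply; rewrite lerXn2r ?nnegrE //.
  by rewrite addr_ge0 // mulr_ge0 // mulr_ge0.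
rewrite -natr1 lerD2r -muln2 natrM [_ * 2]mulrC -mulrA ler_pM2l //.
by rewrite truncn_le // mulr_ge0.
Qed.

(* The points are scaled by [m], of order [2 r / delta], so that the lattice
   balls of radius [r] around their roundings are disjoint; [A] is the union. *)
Lemma packing_step (s : seq X) (delta D r : R) :
  0 < delta -> 0 <= D -> 0 <= r -> uniq s -> (forall x, x \in s -> W x) ->
  {in s &, forall x y, x != y -> delta <= nrm (x - y)} ->
  {in s &, forall x y, nrm (x - y) <= D} ->
  (2 ^ N * (size s * #|` lattice_ball r|) <=
    #|` lattice_ball (2 * (1 + D / delta) * r +
      (2 * c0 * (1 + D / delta) + D + \sum_(i < N) nrm (e i)))|)%N.
Proof.
move=> d0 D0 r0 us sW sd sD; set c1 := \sum_(i < N) _.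
pose m := (Num.truncn ((2 * r + 2 * c0) / delta)).+1.
have ml : 2 * r + 2 * c0 < m%:R * delta.
  by rewrite -ltr_pdivrMr // truncnS_gt.
have [->|s0] := eqVneq s [::]; first by rewrite mul0n muln0.
have c0_ge0 : 0 <= c0.
  case: s s0 sW {us sd sD} => // x s _ /(_ x (mem_head _ _))/W_round[k].
  exact: le_trans.
have mu : m%:R <= (2 * r + 2 * c0) / delta + 1.
  by rewrite /m -natr1 lerD2r truncn_le divr_ge0 ?(ltW d0) //; lra.
have [kk kkP] : exists kk : X -> lattice N,
    forall x, W x -> nrm (x *+ m - lattice_vec (kk x)) <= c0.
  have /choice[kk kkP] : forall x, exists k : lattice N,
      W x -> nrm (x *+ m - lattice_vec k) <= c0.
    move=> x; have [Wx|nWx] := pselect (W x); last by exists 0.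
    by have [k] := W_round (W_MulrMn m Wx); exists k.
  by exists kk.
pose A := [fset z in [seq kk x + l | x <- s, l <- enum_fset (lattice_ball r)]].
have -> : (size s * #|` lattice_ball r| = #|` A|)%N.
  rewrite card_fseq undup_id ?size_allpairs //; apply: allpairs_uniq => //.
    exact: fset_uniq.
  move=> _ _ /allpairsP[[x k] /= [xs kr ->]] /allpairsP[[y l] /= [ys lr ->]] /= eq_kl.
  have [xy|xy] := eqVneq x y; first by move: eq_kl; rewrite xy => /addrI ->.
  (* Scaled points are at least [m delta > 2 r + 2 c0] apart, while a shared lattice point would put
     them within [2 r + 2 c0]. *)
  exfalso; have : m%:R * delta <= nrm (x *+ m - y *+ m).
    by rewrite -mulrnBl nrmMn; apply: ler_wpM2l => //; apply: sd.
  have := kkP _ (sW _ xs); have := kkP _ (sW _ ys).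
  have := dist (x *+ m) (lattice_vec (kk x)) (lattice_vec (kk y)) (y *+ m).
  rewrite (distC (lattice_vec (kk y))).
  have -> : lattice_vec (kk x) - lattice_vec (kk y) = lattice_vec l - lattice_vec k.
    rewrite -!lattice_vecN -!lattice_vecD -[kk x](addrK k) [kk x + k]eq_kl.
    by rewrite addrAC [kk y + l]addrC addrK.
  move: kr lr; rewrite /= !in_lattice_ball => kr lr.
  have := nrmD (lattice_vec l) (- lattice_vec k); rewrite nrmN.
  by lra.
(* The radius adds up two roundings, two ball offsets, [m D] for the scaled points and [c1] for the
   cube; [mu] bounds [m]. *)
apply: doubling_lattice => z z' q; rewrite in_lattice_ball !in_fset /=.
move=> /allpairsP[[x k] /= [xs kr ->]] /allpairsP[[y l] /= [ys lr ->]] qQ.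
have := lattice_vec_cube qQ.
have := kkP _ (sW _ xs); have := kkP _ (sW _ ys).
rewrite !in_lattice_ball in kr lr *; rewrite !lattice_vecD lattice_vecN !lattice_vecD.
have := sD _ _ xs ys; rewrite -/c1.
move: (lattice_vec k) (lattice_vec l) (lattice_vec q) kr lr => u v w ur vr.
set x' := lattice_vec (kk x); set y' := lattice_vec (kk y).
move=> xyD yy' xx' wc1.
rewrite [- (y' + v)]opprD [x' + u + (- y' - v)]addrACA.
have := nrmD (x' - y' + (u - v)) w; have := nrmD (x' - y') (u - v).
have := nrmD u (- v); rewrite nrmN.
have := dist x' (x *+ m) (y *+ m) y'; rewrite (distC x' (x *+ m)) -mulrnBl nrmMn.
have : m%:R * nrm (x - y) <= ((2 * r + 2 * c0) / delta + 1) * D.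
  by apply: ler_pM.
have -> : ((2 * r + 2 * c0) / delta + 1) * D =
    2 * r * (D / delta) + 2 * c0 * (D / delta) + D by ring.
by lra.
Qed.

(* Iterating [packing_step] from radius 0 gives at least
   [(2 ^ N * size s) ^ j] lattice points in a ball of radius
   [O (rho ^ j)], [rho = 2 (1 + D / delta)], against the bound
   [O (rho ^ (N j))] of [card_lattice_ball]; no volume is needed. *)
Theorem packing_bound (s : seq X) (delta D : R) :
  0 < delta -> 0 <= D -> uniq s -> (forall x, x \in s -> W x) ->
  {in s &, forall x y, x != y -> delta <= nrm (x - y)} ->
  {in s &, forall x y, nrm (x - y) <= D} ->
  (size s)%:R <= (1 + D / delta) ^+ N.
Proof.
move=> d0 D0 us sW sd sD.
have [->|s0] := eqVneq s [::].
  by rewrite exprn_ge0 // addr_ge0 // divr_ge0 // ltW.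
set rho := 2 * (1 + D / delta).
have Dd0 : 0 <= D / delta by rewrite divr_ge0 // ltW.
have rho2 : 2 <= rho by rewrite /rho; lra.
set C := 2 * c0 * (1 + D / delta) + D + \sum_(i < N) nrm (e i).
have C0 : 0 <= C.
  have c00 : 0 <= c0.
    case: s s0 sW {us sd sD} => // x s _ /(_ x (mem_head _ _))/W_round[k].
    exact: le_trans.
  by rewrite !addr_ge0 ?sumr_ge0 // !mulr_ge0 // addr_ge0.
(* One step maps the radius [r] to [rho r + C]; the radii [C (rho ^ j - 1)] dominate this recursion
   because [rho >= 2]. *)
have ballj j : ((2 ^ N * size s) ^ j <= #|` lattice_ball (C * (rho ^+ j - 1))|)%N.
  elim: j => [|j IH].
    rewrite expr0 subrr mulr0 expn0 cardfs_gt0; apply/fset0Pn; exists 0.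
    by rewrite in_lattice_ball -(subrr 0) lattice_vecD lattice_vecN subrr nrm0.
  have rj : 1 <= rho ^+ j by rewrite exprn_ege1 //; lra.
  rewrite expnS; apply: leq_trans (leq_mul (leqnn _) IH) _; rewrite -mulnA.
  apply: leq_trans (packing_step d0 D0 _ us sW sd sD) _.
    by rewrite mulr_ge0 // subr_ge0.
  apply/fsubset_leq_card/fsubsetP => k; rewrite !in_lattice_ball -/rho -/C.
  move=> /le_trans; apply; rewrite exprS; have := mulr_ge0 C0 (_ : 0 <= rho - 2).
  rewrite subr_ge0 => /(_ rho2); lra.
(* The [j]-th powers compare up to a factor independent of [j], hence so do the bases; the factor 2
   in [rho] then cancels [2 ^ N]. *)
have : 2 ^+ N * (size s)%:R <= rho ^+ N.
  apply: (@ler_of_exprn_bound _ _ _ ((2 * K * C + 1) ^+ N)).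
  - by rewrite exprn_gt0 //; lra.
  - by rewrite exprn_ge0 // addr_ge0 // !mulr_ge0.
  move=> j; have rj : 1 <= rho ^+ j by rewrite exprn_ege1 //; lra.
  have := ballj j; rewrite -(ler_nat R) natrX natrM natrX => /le_trans; apply.
  apply: le_trans (card_lattice_ball _) _.
    by rewrite mulr_ge0 // subr_ge0.
  rewrite exprAC -exprMn lerXn2r ?nnegrE //.
  - by rewrite addr_ge0 // !mulr_ge0 // subr_ge0.
  - by rewrite mulr_ge0 ?addr_ge0 ?mulr_ge0 //; lra.
  - have := mulr_ge0 (mulr_ge0 K_ge0 C0) (_ : 0 <= 1); lra.
by rewrite exprMn ler_pM2l // exprn_gt0.
Qed.

End Packing.

(** * The real norm and real lattices of a real or complex Hilbert space *)

Local Open Scope complex_scope.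

Section Scalars.
Variables (R : realType) (c : scalar_kind).
Implicit Types (a b : R).

(** Meant for nonnegative scalars, which are real in [R[i]] too, so that norms become elements of
    [R] without loss. *)
Definition to_real : scalars R c -> R :=
  match c with
  | RealScalars => fun x => x
  | ComplexScalars => fun z => complex.Re z
  end.

Lemma of_realK : cancel (@of_real R c) to_real.
Proof. by rewrite /of_real /to_real; case: c. Qed.

Lemma to_realK (x : scalars R c) : 0 <= x -> of_real c (to_real x) = x.
Proof.
rewrite /of_real /to_real; case: c x => //= x x0.
by rewrite RRe_real // ger0_real.
Qed.

Lemma ler_of_real a b : (of_real c a <= of_real c b) = (a <= b).
Proof. by rewrite /of_real; case: c; rewrite // lecR. Qed.

Lemma ltr_of_real a b : (of_real c a < of_real c b) = (a < b).
Proof. by rewrite /of_real; case: c; rewrite // ltcR. Qed.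

Lemma of_real0 : of_real c 0 = 0 :> scalars R c.
Proof. by rewrite /of_real; case: c. Qed.

Lemma of_realD a b : of_real c (a + b) = of_real c a + of_real c b.
Proof. by rewrite /of_real; case: c; rewrite //= rmorphD. Qed.

Lemma of_realM a b : of_real c (a * b) = of_real c a * of_real c b.
Proof. by rewrite /of_real; case: c; rewrite //= rmorphM. Qed.

Lemma of_realMn a m : of_real c (a *+ m) = of_real c a *+ m.
Proof. by rewrite /of_real; case: c; rewrite //= rmorphMn. Qed.

End Scalars.
Arguments to_real {R c}.

Section RealNorm.
Variables (R : realType) (c : scalar_kind) (X : completeNormedModType (scalars R c)).
Implicit Types (x y : X).

Definition rnorm x : R := to_real `|x|.

Lemma of_rnorm x : of_real c (rnorm x) = `|x|.
Proof. exact: to_realK. Qed.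

Lemma rnorm_ge0 x : 0 <= rnorm x.
Proof. by rewrite -(ler_of_real c) of_rnorm of_real0. Qed.

Lemma rnormD x y : rnorm (x + y) <= rnorm x + rnorm y.
Proof. by rewrite -(ler_of_real c) of_realD !of_rnorm ler_normD. Qed.

Lemma rnormN x : rnorm (- x) = rnorm x.
Proof. by rewrite /rnorm normrN. Qed.

Lemma rnormMn x m : rnorm (x *+ m) = m%:R * rnorm x.
Proof.
by rewrite mulr_natl -[RHS](@of_realK _ c) of_realMn of_rnorm -normrMn.
Qed.

Lemma rnormZ (u : scalars R c) x : rnorm (u *: x) = to_real `|u| * rnorm x.
Proof. by rewrite -[RHS](@of_realK _ c) of_realM of_rnorm to_realK // -normrZ. Qed.

Lemma rnorm_sum n (F : 'I_n -> X) : rnorm (\sum_i F i) <= \sum_i rnorm (F i).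
Proof.
elim/big_ind2: _ => [|x a y b xa yb|i _ //]; first by rewrite -(mulr0n 0) rnormMn mul0r.
by apply: le_trans (rnormD _ _) _; apply: lerD.
Qed.

Variable dot : {dot X for @scalar_conj R c}.
Hypothesis hX : hilbert_norm dot.

Lemma rnorm_pythagoras x y : dot x y = 0 ->
  rnorm (x + y) ^+ 2 = rnorm x ^+ 2 + rnorm y ^+ 2.
Proof.
move=> xy0; apply: (can_inj (@of_realK _ c)).
by rewrite of_realD !expr2 !of_realM !of_rnorm -!expr2 !hX hnormDd.
Qed.

(** Cauchy-Schwarz: [a *: y] is the orthogonal projection of [x] on the line of [y], hence no longer
    than [x]. *)
Lemma dot_le_rnorm x y : to_real `|dot x y| <= rnorm x * rnorm y.
Proof.
rewrite -(ler_of_real c) of_realM to_realK // !of_rnorm.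
have [->|y0] := eqVneq y 0; first by rewrite linear0r !normr0 mulr0.
have yy0 : dot y y != 0 by rewrite -hX expf_neq0 // normr_eq0.
set a := dot x y / dot y y.
have yz : dot (a *: y) (x - a *: y) = 0.
  have : dot (x - a *: y) y = 0 by rewrite linearBl linearZl_LR /= divfK ?subrr.
  move=> h; rewrite linearZl_LR /=.
  have -> : dot y (x - a *: y) = scalar_conj R c (dot (x - a *: y) y).
    by rewrite -[RHS]mul1r -[1]/((-1) ^+ false); apply: hermC.
  by rewrite h rmorph0 mulr0.
have : `|a *: y| <= `|x|.
  rewrite -(@ler_pXn2r _ 2) ?nnegrE // !hX.
  have -> : dot x x = dot (a *: y) (a *: y) + dot (x - a *: y) (x - a *: y).
    by rewrite -hnormDd // subrKC.
  by rewrite lerDl -hX exprn_ge0.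
rewrite normrZ => h.
have -> : `|dot x y| = `|a| * `|y| * `|y|.
  by rewrite -mulrA -expr2 hX -[X in _ * X]ger0_norm -?hX ?exprn_ge0 // hX -normrM divfK.
by rewrite ler_wpM2r.
Qed.

End RealNorm.

Lemma to_real_normD (R : realType) (c : scalar_kind) (u v : scalars R c) :
  to_real `|u + v| <= to_real `|u| + to_real `|v|.
Proof. by rewrite -(ler_of_real c) of_realD !to_realK // ler_normD. Qed.

Lemma to_real_normM (R : realType) (c : scalar_kind) (u v : scalars R c) :
  to_real `|u * v| = to_real `|u| * to_real `|v|.
Proof.
by rewrite -[RHS](@of_realK _ c) of_realM !to_realK // normrM.
Qed.

Lemma to_real_norm_ge0 (R : realType) (c : scalar_kind) (u : scalars R c) :
  0 <= to_real `|u|.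
Proof. by rewrite -(ler_of_real c) to_realK // of_real0. Qed.

Section Coordinates.
Variables (R : realType) (c : scalar_kind) (X : completeNormedModType (scalars R c)).
Variables (dot : {dot X for @scalar_conj R c}) (hX : hilbert_norm dot).
Variables (n : nat) (e : 'I_n -> X).

(* The coordinates of [x] in [e] are the products of [x] with the [e j], times
   the inverse of the Gram matrix. *)
Lemma coordinate_bound :
  (forall u : 'I_n -> scalars R c, \sum_(i < n) u i *: e i = 0 -> forall i, u i = 0) ->
  exists2 K : R, 0 <= K &
    forall (u : 'I_n -> scalars R c) i,
      to_real `|u i| <= K * rnorm (\sum_(i < n) u i *: e i).
Proof.
move=> free_e; pose G := \matrix_(i < n, j < n) dot (e i) (e j).
have rowG (u : 'rV_n) j : (u *m G) 0 j = dot (\sum_i u 0 i *: e i) (e j).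
  rewrite mxE linear_sumlz; apply: eq_bigr => i _.
  by rewrite mxE linearZl_LR.
(* A row in the kernel of the Gram matrix gives a vector of the span orthogonal to the span, hence
   to itself. *)
have Gu : G \in unitmx.
  rewrite -row_free_unit -kermx_eq0; apply/rowV0P => u /sub_kermxP uG.
  have := rowG u; set x := \sum_i u 0 i *: e i => xG.
  have x_ortho (w : 'I_n -> scalars R c) : dot x (\sum_i w i *: e i) = 0.
    rewrite linear_sumr big1 // => i _; rewrite linearZr_LR /= -xG uG mxE.
    exact: mulr0.
  have x0 : x = 0.
    by apply/eqP; rewrite -normr_eq0 -sqrf_eq0 hX x_ortho.
  by apply/rowP => i; rewrite mxE; apply: (free_e _ x0).
pose K := \sum_i \sum_j rnorm (e j) * to_real `|invmx G j i|.
exists K => [|u i].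
  rewrite sumr_ge0 // => i _; rewrite sumr_ge0 // => j _.
  by rewrite mulr_ge0 ?rnorm_ge0 ?to_real_norm_ge0.
set x := \sum_(i < n) _.
have -> : u i = \sum_j dot x (e j) * invmx G j i.
  pose v := \row_i u i; have -> : u i = v 0 i by rewrite mxE.
  rewrite -[v](mulmxK Gu) mxE; apply: eq_bigr => j _; rewrite rowG.
  by congr (dot _ _ * _); apply: eq_bigr => k _; rewrite mxE.
apply: (@le_trans _ _ (\sum_j rnorm (e j) * to_real `|invmx G j i| * rnorm x)).
  elim/big_ind2: _ => [|a b a' b' h h'|j _]; first by rewrite normr0 -(of_real0 R c) of_realK.
    by apply: le_trans (to_real_normD _ _) _; apply: lerD.
  rewrite to_real_normM mulrAC ler_wpM2r ?to_real_norm_ge0 // mulrC.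
  exact: dot_le_rnorm.
rewrite -mulr_suml ler_wpM2r ?rnorm_ge0 // /K [leRHS](bigD1 i) //= lerDl.
rewrite sumr_ge0 // => k _; rewrite sumr_ge0 // => j _.
by rewrite mulr_ge0 ?rnorm_ge0 ?to_real_norm_ge0.
Qed.
End Coordinates.

(** The value 0 over [R] lets a single formula for [digit] serve both fields. *)
Definition second_unit (R : realType) (c : scalar_kind) : scalars R c :=
  match c with RealScalars => 0 | ComplexScalars => 'i end.

(** An integer over [R], a Gaussian integer over [R[i]], whose imaginary parts are stored from index
    [n] on. *)
Definition digit (R : realType) (c : scalar_kind) (n : nat) (z : nat -> int)
    (i : 'I_n) : scalars R c :=
  (z i)%:~R + (z (n + i)%N)%:~R * second_unit R c.

(* Over [R[i]] the real basis of the span of [e] consists of the [e j],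
   followed by the ['i *: e j]; over [R] only the indices [j < n] are used. *)
Definition real_basis (R : realType) (c : scalar_kind)
    (X : completeNormedModType (scalars R c)) (n : nat) (e : 'I_n -> X) (j : nat) : X :=
  if (j < n)%N then oapp e 0 (insub j)
  else second_unit R c *: oapp e 0 (insub (j - n)%N).

Lemma to_real_complex_norm (R : realType) (z : scalars R ComplexScalars) :
  to_real `|z| = Num.sqrt (complex.Re z ^+ 2 + complex.Im z ^+ 2).
Proof. by rewrite /to_real (normc_def (z : R[i])). Qed.

Lemma complex_digit (R : realType) n (z : nat -> int) (i : 'I_n) :
  digit R ComplexScalars z i = (z i)%:~R +i* (z (n + i)%N)%:~R.
Proof.
by rewrite /digit /= [RHS]complexE /= !rmorph_int [in RHS]mulrC.
Qed.

Lemma sum_real_basis (R : realType) (c : scalar_kind)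
    (X : completeNormedModType (scalars R c)) (n : nat) (e : 'I_n -> X)
    (z : nat -> int) :
  \sum_(i < real_dim c n) real_basis e i *~ z i = \sum_(i < n) digit R c z i *: e i.
Proof.
have first_half : \sum_(i < n) real_basis e i *~ z i = \sum_(i < n) (z i)%:~R *: e i.
  by apply: eq_bigr => i _; rewrite /real_basis ltn_ord valK /= scaler_int.
case: c X e first_half => X e first_half.
  by rewrite first_half; apply: eq_bigr => i _; rewrite /digit mulr0 addr0.
rewrite /= mul2n -addnn big_split_ord /= first_half -big_split /=.
apply: eq_bigr => i _; rewrite /digit scalerDl; congr (_ + _).
rewrite /real_basis ltnNge leq_addr /= addKn valK /=.
by rewrite -scaler_int scalerA.
Qed.

Lemma norm_sub_floor (R : realType) (x : R) : `|x - (Num.floor x)%:~R| <= 1.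
Proof.
have := floor_le x; have := floorD1_gt x; rewrite intrD => h1 h2.
by rewrite ger0_norm; lra.
Qed.

(** Taking floors of real and imaginary parts costs at most 1 in each, so the modulus of the error
    is at most [sqrt 2]. *)
Lemma digit_approx (R : realType) (c : scalar_kind) n (u : 'I_n -> scalars R c) :
  exists z, forall i, to_real `|u i - digit R c z i| <= 2.
Proof.
pose v j := oapp u 0 (insub j); have vE (i : 'I_n) : v i = u i by rewrite /v valK.
case: c u v vE => u v vE.
  exists (fun j => Num.floor (v j)) => i; rewrite /digit mulr0 addr0 vE.
  by apply: le_trans (norm_sub_floor _) _; lra.
exists (fun j => if (j < n)%N then Num.floor (complex.Re (v j))
          else Num.floor (complex.Im (v (j - n)%N))) => i.
rewrite to_real_complex_norm complex_digit ltn_ord ltnNge leq_addr /= addKn vE.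
case: (u i) => a b /=.
have ha := norm_sub_floor a; have hb := norm_sub_floor b.
rewrite -[leRHS]ger0_norm // -sqrtr_sqr ler_wsqrtr //.
have sq1 (t : R) : `|t| <= 1 -> t ^+ 2 <= 1.
  by rewrite -[t ^+ 2]real_normK ?num_real // => t1; rewrite exprn_ile1.
by have := sq1 _ ha; have := sq1 _ hb; lra.
Qed.

(** Each integer coordinate is a digit, or the real or imaginary part of one; this carries
    [coordinate_bound] over to the lattice. *)
Lemma digit_ge (R : realType) (c : scalar_kind) n (z : nat -> int) j :
  (j < real_dim c n)%N ->
  exists i : 'I_n, `|z j|%:~R <= to_real `|digit R c z i|.
Proof.
case: c => jn.
  by exists (Ordinal jn); rewrite /digit mulr0 addr0 /= intr_norm.
have [jn'|nj] := ltnP j n.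
  exists (Ordinal jn'); rewrite to_real_complex_norm complex_digit /= intr_norm.
  by rewrite -sqrtr_sqr ler_wsqrtr // lerDl sqr_ge0.
have jn' : (j - n < n)%N by move: jn; rewrite /=; lia.
exists (Ordinal jn'); rewrite to_real_complex_norm complex_digit /= subnKC // intr_norm.
by rewrite -sqrtr_sqr ler_wsqrtr // lerDr sqr_ge0.
Qed.

Local Close Scope complex_scope.

(** * Covers by sets of small diameter *)

Section Covering.
Variables (R : realType) (c : scalar_kind) (X : completeNormedModType (scalars R c)).
Implicit Types (A G C : set X) (d : R).

Definition separated (d : R) (s : seq X) :=
  {in s &, forall x y, x != y -> d <= rnorm (x - y)}.

Lemma packing_subspace (dot : {dot X for @scalar_conj R c}) (n : nat)
    (W : set X) (s : seq X) (delta D : R) :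
  hilbert_norm dot -> subspace_of_dim n W -> 0 < delta -> 0 <= D -> uniq s ->
  (forall x, x \in s -> W x) -> separated delta s ->
  {in s &, forall x y, rnorm (x - y) <= D} ->
  (size s)%:R <= (1 + D / delta) ^+ real_dim c n.
Proof.
move=> hX [e [free_e ->]] d0 D0 us sW sd sD.
have [K K0 Kb] := coordinate_bound hX free_e.
apply: (@packing_bound _ _ _ (@rnormD _ _ X) (@rnormN _ _ X) (@rnormMn _ _ X) _
  (real_basis e) [set \sum_(i < n) u i *: e i | u in [set: 'I_n -> scalars R c]]
  (\sum_i 2 * rnorm (e i)) K _ _ K0 _ s) => //.
- move=> _ m [u _ <-]; exists (fun i => u i *+ m) => //.
  by rewrite -sumrMnl; apply: eq_bigr => i _; rewrite scalerMnl.
- move=> _ [u _ <-]; have [z zP] := digit_approx u.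
  exists (lattice_of z _).
  have -> : lattice_vec (real_basis e) (lattice_of z (real_dim c n)) =
      \sum_(i < n) digit R c z i *: e i.
    by rewrite -sum_real_basis; apply: eq_bigr => i _; rewrite zcoord_lattice_of.
  rewrite -sumrB; apply: le_trans (rnorm_sum _) _; apply: ler_sum => i _.
  by rewrite -scalerBl rnormZ ler_wpM2r ?rnorm_ge0.
- move=> k i /(digit_ge R (zcoord k))[j]; move/le_trans; apply.
  by rewrite /lattice_vec sum_real_basis.
Qed.

(** If no such net existed, every separated list could be extended by a point far from all its
    members, eventually exceeding length [h]. *)
Lemma maximal_separated G d (h : R) : 0 < d ->
  (forall s, uniq s -> (forall x, x \in s -> G x) -> separated d s ->
     (size s)%:R <= h) ->
  exists s : seq X, [/\ (forall x, x \in s -> G x), (size s)%:R <= h &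
    forall x, G x -> exists2 p, p \in s & rnorm (x - p) < d].
Proof.
move=> d0 Gh; apply: contrapT => noG.
suff long m : exists s, [/\ size s = m, uniq s, (forall x, x \in s -> G x) &
    separated d s].
  have [s [sm us sG sd]] := long (Num.truncn h).+1.
  by have := Gh s us sG sd; rewrite sm leNgt truncnS_gt.
elim: m => [|m [s [<- us sG sd]]]; first by exists [::]; split.
have [x [Gx xs]] : exists x, G x /\ forall p, p \in s -> d <= rnorm (x - p).
  apply: contrapT => nx; apply: noG; exists s; split => //; first exact: Gh.
  move=> x Gx; apply: contrapT => np; apply: nx; exists x; split => // p ps.
  by rewrite leNgt; apply/negP => xp; apply: np; exists p.
have x0 : rnorm (x - x) = 0 by rewrite subrr -(mulr0n 0) rnormMn mul0r.
exists (x :: s); split => //=.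
- by rewrite us andbT; apply/negP => /xs; rewrite x0; lra.
- by move=> y; rewrite inE => /predU1P[->|/sG].
- move=> y z; rewrite !inE => /predU1P[->|ys] /predU1P[->|zs] yz.
  + by rewrite eqxx in yz.
  + exact: xs.
  + by rewrite -rnormN opprB; apply: xs.
  + exact: sd.
Qed.

Definition diam_le C d := forall x y, C x -> C y -> rnorm (x - y) <= d.

Definition covers (ss : seq (set X)) G := forall x, G x -> exists2 C, C \in ss & C x.

(** One point of [G] is chosen in each piece that meets [G], since covering balls must be centred in
    [G]. *)
Lemma pick_centers (ss : seq (set X)) G :
  exists s : seq X, [/\ (size s <= size ss)%N, (forall x, x \in s -> G x) &
    forall C y, C \in ss -> G y -> C y -> exists2 x, x \in s & C x].
Proof.
elim: ss => [|C ss [s [sss sG sC]]]; first by exists [::]; split.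
have [[x [Gx Cx]]|nx] := pselect (exists x, G x /\ C x).
  exists (x :: s); split => //= [y|C' y]; rewrite inE.
    by move=> /predU1P[->|/sG].
  move=> /predU1P[-> _ _|C's Gy C'y]; first by exists x => //; rewrite mem_head.
  have [z zs C'z] := sC _ _ C's Gy C'y.
  by exists z => //; rewrite inE zs orbT.
exists s; split => //= [|C' y]; first exact: leqW.
rewrite inE => /predU1P[-> Gy Cy|]; last exact: sC.
by case: nx; exists y.
Qed.

Lemma refine_cover (F : X -> X) (ss : seq (set X)) G (h : R) d d' :
  (forall C, diam_le C d -> exists cs : seq (set X),
     [/\ (size cs)%:R <= h, covers cs (F @` (C `&` G)) &
       forall C', C' \in cs -> diam_le C' d']) ->
  covers ss G -> (forall C, C \in ss -> diam_le C d) ->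
  exists ss', [/\ (size ss')%:R <= h * (size ss)%:R, covers ss' (F @` G) &
    forall C, C \in ss' -> diam_le C d'].
Proof.
move=> hF ssG ssd.
(* Coverage is restated piece by piece because a tail of [ss] need not cover [G]. *)
suff [ss' [h1 h2 h3]] : exists ss' : seq (set X),
    [/\ (size ss')%:R <= h * (size ss)%:R,
      forall C x, C \in ss -> C x -> G x -> exists2 C', C' \in ss' & C' (F x) &
      forall C, C \in ss' -> diam_le C d'].
  exists ss'; split => // _ [x Gx <-]; have [C Css Cx] := ssG _ Gx.
  exact: h2 Cx Gx.
elim: ss ssd {ssG} => [|C ss IH] ssd; first by exists [::]; rewrite mulr0; split.
have [cs [cs1 cs2 cs3]] := hF _ (ssd _ (mem_head _ _)).
have [|ss' [h1 h2 h3]] := IH; first by move=> C' C's; apply: ssd; rewrite inE C's orbT.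
exists (cs ++ ss'); split => /= [|C' x|C'].
- by rewrite size_cat natrD -natr1 mulrDr mulr1 addrC lerD.
- rewrite inE => /predU1P[->|C's] C'x Gx.
    have [|C'' Ccs C''x] := cs2 (F x); first by exists x.
    by exists C'' => //; rewrite mem_cat Ccs.
  have [C'' Ccs C''x] := h2 _ _ C's C'x Gx.
  by exists C'' => //; rewrite mem_cat Ccs orbT.
- by rewrite mem_cat => /orP[/cs3|/h3].
Qed.

(** An open ball centred in a piece contains the piece once its radius strictly exceeds the
    diameter. *)
Lemma covering_number_le (V G : set X) (ss : seq (set X)) (d eps : R) :
  G `<=` V -> covers ss G -> (forall C, C \in ss -> diam_le C d) -> d < eps ->
  (covering_number V G eps <= (size ss)%:R%:E)%E.
Proof.
move=> GV ssG ssd de; have [s [sss sG sC]] := pick_centers ss G.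
apply: (@le_trans _ _ (size s)%:R%:E); last by rewrite lee_fin ler_nat.
apply: ereal_inf_lbound; exists s => //; split => // y Gy.
have [C Css Cy] := ssG _ Gy; have [x xs Cx] := sC _ _ Css Gy Cy.
exists x => //; split; first exact: GV.
rewrite -ball_normE /ball_ /= -of_rnorm ltr_of_real.
by apply: le_lt_trans de; apply: ssd Css _ _ _ _.
Qed.

Lemma bounded_set_rnorm (B : set X) :
  bounded_set B -> exists2 M : R, 0 <= M & forall x, B x -> rnorm x <= M.
Proof.
case=> M [Mreal MB]; exists (to_real (`|M| + 1)).
  by rewrite -(ler_of_real c) of_real0 to_realK addr_ge0.
move=> x Bx; rewrite -(ler_of_real c) of_rnorm to_realK ?addr_ge0 //.
by apply: MB Bx; rewrite ltr_pwDr // real_ler_norm.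
Qed.

End Covering.

(** * Covering the image under one time step [T] *)

Lemma ladyzhenskaya_cover (R : realType) (c : scalar_kind)
    (X : completeNormedModType (scalars R c)) (dot : {dot X for @scalar_conj R c})
    (S : R -> X -> X) (B A : set X) (T : R) (n : nat) (eta kappa sigma d : R)
    (W : set X) (P : X -> X) :
  hilbert_norm dot -> orthogonal_projection dot P W ->
  ladyzhenskaya_type S B T n eta kappa W P ->
  0 < sigma -> 0 < d -> A `<=` B -> diam_le A d ->
  exists cs : seq (set X),
    [/\ (size cs)%:R <= (1 + 2 * kappa / sigma) ^+ real_dim c n,
      covers cs (S T @` A) &
      forall C, C \in cs -> diam_le C (d * Num.sqrt (sigma ^+ 2 + eta ^+ 2))].
Proof.
move=> hX [linP PP _ orthoP] [[n0 dimW] WP /andP[eta0 eta1] kappa0 lip] sigma0 d0 AB Ad.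
pose PL : {linear X -> X} := HB.pack P (GRing.isLinear.Build _ _ _ _ P linP).
have PB x y : P (x - y) = P x - P y by exact: (raddfB PL).
have lipP x y : A x -> A y -> rnorm (P (S T x) - P (S T y)) <= kappa * rnorm (x - y).
  move=> /AB Bx /AB By; have [_] := lip _ _ Bx By.
  by rewrite -!of_rnorm -of_realM ler_of_real.
have lipQ x y : A x -> A y ->
    rnorm ((S T x - P (S T x)) - (S T y - P (S T y))) <= eta * rnorm (x - y).
  move=> /AB Bx /AB By; have [+ _] := lip _ _ Bx By.
  by rewrite -!of_rnorm -of_realM ler_of_real.
have sd0 : 0 < sigma * d / 2 by rewrite divr_gt0 // mulr_gt0.
have [] := @maximal_separated _ _ _ [set P (S T y) | y in A] (sigma * d / 2)
    ((1 + 2 * kappa / sigma) ^+ real_dim c n) sd0.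
  move=> s us sA ssep.
  (* The ratio of diameter [kappa d] to separation [sigma d / 2]. *)
  have -> : 2 * kappa / sigma = kappa * d / (sigma * d / 2).
    by field; rewrite !gt_eqF.
  apply: packing_subspace hX dimW sd0 _ us _ ssep _.
  - by rewrite mulr_ge0 ?ltW.
  - by move=> x /sA[y _ <-].
  - move=> _ _ /sA[x Ax <-] /sA[y Ay <-]; apply: le_trans (lipP _ _ Ax Ay) _.
    by apply: ler_wpM2l; [exact: ltW|exact: Ad].
move=> s [sA hs scov].
exists [seq [set S T y | y in
  [set y | A y /\ rnorm (P (S T y) - p) < sigma * d / 2]] | p <- s].
split; first by rewrite size_map.
  move=> _ [y Ay <-]; have [|p ps yp] := scov (P (S T y)); first by exists y.
  by eexists; [apply: map_f ps | exists y].
move=> _ /mapP[p _ ->] _ _ [x [Ax xp] <-] [y [Ay yp] <-].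
(* Both projections lie within [sigma d / 2] of the same net point [p]. *)
have Pxy : rnorm (P (S T x - S T y)) <= sigma * d.
  rewrite PB -(subrKA p); apply: le_trans (rnormD _ _) _.
  by move: yp; rewrite -rnormN opprB; lra.
have Qxy : rnorm (S T x - S T y - P (S T x - S T y)) <= eta * d.
  have -> : S T x - S T y - P (S T x - S T y) =
      (S T x - P (S T x)) - (S T y - P (S T y)) by rewrite PB !opprD addrACA.
  apply: le_trans (lipQ _ _ Ax Ay) _.
  by apply: ler_wpM2l => //; apply: Ad.
set v := S T x - S T y in Pxy Qxy *.
(* Orthogonality lets the bounds [sigma d] and [eta d] combine by Pythagoras. *)
have Pv : dot (P v) (v - P v) = 0 by apply: orthoP; rewrite PB PP subrr.
rewrite -(@ler_pXn2r _ 2) ?nnegrE ?rnorm_ge0 ?mulr_ge0 ?sqrtr_ge0 ?(ltW d0) //.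
rewrite exprMn sqr_sqrtr ?addr_ge0 ?sqr_ge0 // -[v](subrKC (P v)).
rewrite (rnorm_pythagoras hX Pv) mulrDr.
by apply: lerD; rewrite -exprMn mulrC lerXn2r ?nnegrE ?rnorm_ge0 // mulr_ge0 // ltW.
Qed.

(** * Iteration over the multiples of [T] *)

Theorem proposition7p5 (R : realType) (c : scalar_kind)
    (X : completeNormedModType (scalars R c)) (dot : {dot X for @scalar_conj R c})
    (hX : hilbert_norm dot)
    (V : set X) (hV : V !=set0)
    (tk : time_kind) (S : R -> X -> X) (hS : semigroup_on tk V S)
    (T : R) (hT : time_set tk T) (hT0 : 0 < T)
    (B : set X) (hBV : B `<=` V) (hB : bounded_set B)
    (hSB : S T @` B `<=` B)
    (n : nat) (eta kappa : R) (W : set X) (P : X -> X)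
    (hP : orthogonal_projection dot P W)
    (hL : ladyzhenskaya_type S B T n eta kappa W P)
    (sigma : R) (hsigma : 0 < sigma < Num.sqrt (1 - eta ^+ 2)) :
  let q : R := Num.sqrt (sigma ^+ 2 + eta ^+ 2) in
  let h : R := (1 + 2 * kappa / sigma) ^+ real_dim c n in
  exists (k0 : nat) (a b : R), [/\ (0 < k0)%N, 0 < a, 0 < b &
    forall k : nat, (k0 <= k)%N ->
      (covering_number V (S (k%:R * T)%R @` B) (a * q ^+ k)%R
         <= (b * h ^+ k)%R%:E)%E].
Proof.
move=> q h; have /andP[sigma0 _] := hsigma.
(* [B] has diameter at most [2 M]; the extra 1 keeps [d] positive. *)
have [M M0 BM] := bounded_set_rnorm hB; pose d := 2 * M + 1.
have d0 : 0 < d by rewrite /d; lra.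
have q0 : 0 < q by rewrite sqrtr_gt0 ltr_wpDr ?sqr_ge0 ?exprn_gt0.
have kT k : time_set tk (k%:R * T).
  case: tk hT {hS} => /= [T0|[m _ <-]]; first by rewrite mulr_ge0.
  by exists (k * m)%N => //; rewrite natrM.
have [SV SD S0] := hS.
have SSk k : S (k.+1%:R * T) @` B = S T @` (S (k%:R * T) @` B).
  rewrite image_comp; apply: eq_imagel => x Bx /=.
  by rewrite (SD _ _ hT (kT k) _ (hBV _ Bx)) -natr1 mulrDl mul1r addrC.
have SkB k : S (k%:R * T) @` B `<=` B.
  elim: k => [|k IH]; last by rewrite SSk; apply: subset_trans hSB; apply: image_subset.
  by move=> _ [x Bx <-]; rewrite mul0r S0 //; exact: hBV.
(* Each time step multiplies the number of pieces by at most [h] and the diameter bound by [q]. *)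
have cover k : exists ss : seq (set X), [/\ (size ss)%:R <= h ^+ k,
    covers ss (S (k%:R * T) @` B) & forall C, C \in ss -> diam_le C (d * q ^+ k)].
  elim: k => [|k [ss [ssh ssB ssd]]].
    exists [:: B]; split => //= [x|C].
      by move=> /SkB Bx; exists B => //; rewrite mem_head.
    rewrite inE => /eqP -> x y /BM xM /BM yM; rewrite expr0 mulr1 /d.
    by have := rnormD x (- y); rewrite rnormN; lra.
  have h0 : 0 <= h.
    have [_ _ _ kappa0 _] := hL.
    by rewrite exprn_ge0 // addr_ge0 // divr_ge0 ?mulr_ge0 ?ltW.
  have [|ss' [ss'h ss'B ss'd]] :=
    refine_cover (F := S T) (h := h) (d' := d * q ^+ k.+1) _ ssB ssd.
    move=> C Cd; rewrite exprSr mulrA.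
    apply: ladyzhenskaya_cover hX hP hL sigma0 _ _ _.
    - by rewrite mulr_gt0 // exprn_gt0.
    - by move=> x [_ /SkB].
    - by move=> x y [Cx _] [Cy _]; apply: Cd.
  exists ss'; rewrite SSk; split => //; apply: le_trans ss'h _.
  by rewrite exprS ler_wpM2l.
(* Taking [a = d + 1 > d] gives the strict inequality that open balls require. *)
exists 1%N, (d + 1), 1; split => //; first lra.
move=> k _; have [ss [ssh ssB ssd]] := cover k.
apply: (le_trans (covering_number_le _ ssB ssd _)); last by rewrite mul1r lee_fin.
  exact: subset_trans (SkB k) hBV.
by rewrite ltr_pM2r ?exprn_gt0 // ltrDl.
Qed.
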